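(* There is an absolute constant $c>0$ such that the following holds. Let $T$ be a directed tree with degree $d\ge 3$ and let $\ell\ge 1$ be the length of a longest directed path in $T$. Then the span of $T$ is at most $c\,(d-1)^{\ell}$; that is, the span of $T$ is in $O((d-1)^\ell)$.
   Context: A directed tree is a DAG (directed acyclic graph) whose underlying undirected graph is a tree. The degree of a vertex is its total number of incident edges; the degree of a graph is the maximum degree of its vertices. The length of a directed path is its number of edges. An upward-planar layered drawing of a DAG $G$ maps each vertex $v$ to a point in the plane whose y-coordinate $y(v)$ is an integer, and each edge $(u,v)$ (directed from tail $u$ to head $v$) to a strictly y-monotone curve going upward from $u$ to $v$ (so $y(u)<y(v)$), such that no two edges intersect except at common endpoints. The span of an edge $(u,v)$ in such a drawing $\Gamma$ is $y(v)-y(u)$; the span of $\Gamma$ is the maximum span of its edges; the span of an upward-planar DAG is the minimum span over all its upward-planar layered drawings (no embedding prescribed). *)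

(* Defs.v *)
From Stdlib Require Import Reals ZArith.
From mathcomp Require Import all_boot.
Set Implicit Arguments. Unset Strict Implicit. Unset Printing Implicit Defensive.

Section Graphs.
Variable V : finType.
Variable E : rel V.  (* E u v : directed edge from tail u to head v *)

Definition uadj : rel V := fun u v => E u v || E v u.

Definition dag : Prop := forall u v, E u v -> ~~ connect E v u.

Definition directed_tree : Prop :=
  dag /\ (0 < #|V|)%N /\ (forall u v, connect uadj u v) /\
  #|[set p : V * V | E p.1 p.2]| = #|V|.-1.

Definition vdeg (v : V) : nat := #|[set w | uadj v w]|.

Definition max_degree : nat := \max_(v : V) vdeg v.

(* a directed path x :: p has length size p (number of edges);
   l is the length of a longest directed path *)
Definition longest_path_length (l : nat) : Prop :=
  (exists x p, path E x p /\ size p = l) /\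
  (forall x p, path E x p -> (size p <= l)%N).

(* Upward-planar layered drawing: vertex v at point (x v, IZR (y v)) with
   integer y; each edge (u,v) is the strictly y-monotone curve
   { (f u v t, t) | y u <= t <= y v } with f u v continuous. *)
Definition on_edge (y : V -> Z) (f : V -> V -> R -> R) u v (t : R) : Prop :=
  E u v /\ Rle (IZR (y u)) t /\ Rle t (IZR (y v)).

Definition upward_planar_layered_drawing (y : V -> Z) (x : V -> R)
    (f : V -> V -> R -> R) : Prop :=
  (forall u v, x u = x v -> y u = y v -> u = v) /\
  (forall u v, E u v ->
     (y u < y v)%Z /\ continuity (f u v) /\
     f u v (IZR (y u)) = x u /\ f u v (IZR (y v)) = x v) /\
  (forall u v w t, on_edge y f u v t -> f u v t = x w -> t = IZR (y w) ->
     w = u \/ w = v) /\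
  (forall u1 v1 u2 v2 t, on_edge y f u1 v1 t -> on_edge y f u2 v2 t ->
     (u1, v1) <> (u2, v2) -> f u1 v1 t = f u2 v2 t ->
     exists w, (w = u1 \/ w = v1) /\ (w = u2 \/ w = v2) /\
               t = IZR (y w) /\ f u1 v1 t = x w).

(* the span of E (min over drawings of the max edge span) is at most B *)
Definition span_at_most (B : R) : Prop :=
  exists y x f, upward_planar_layered_drawing y x f /\
    forall u v, E u v -> Rle (IZR (y v - y u)) B.

End Graphs.

(* Main.v *)
Require Import Defs.
From Stdlib Require Import Reals ZArith.
From mathcomp Require Import all_boot.
From Stdlib Require Import Lia Lra.
Set Implicit Arguments. Unset Strict Implicit. Unset Printing Implicit Defensive.

(* Root the tree at a source [r], namely the start of a longest directed path, and draw the
   subtree of each vertex [v] so that the region to the right of [v] and above it stays free;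
   the rest of the subtree extends [v] to the left, arbitrarily far upwards but only a bounded
   depth below [v].  The subtrees of the children are attached one after the other at the far
   left.  First come the children that are heads of edges from [v]: their subtrees are lifted
   entirely above [v], and the edge from [v] passes below what is already drawn and reaches the
   child through a free vertical lane.  Then come the children that are tails of edges to [v]:
   each is put just below everything drawn so far, and its edge runs underneath to a lane on the
   right, and then up to [v].  Only the latter children increase the depth, and there are at most
   [d - 1] of them because [v] has a parent or is the source [r].  If [h] bounds the length of
   the directed paths ending at [v], the depth below [v] is thus at most [b h], where [b 0 = 0]
   and [b (h + 1) = (d - 1) (b h + 2)], and every span is at most [b l + 1 <= 4 (d - 1) ^ l]. *)

(** * Piecewise linear curves *)

Section PiecewiseLinear.
Local Open Scope R_scope.

(** The projection of the line onto the interval from 0 to 1, written with absolute values so that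
    continuity follows from that of [Rabs]. *)
Definition clamp (s : R) : R := (Rabs s - Rabs (s - 1) + 1) / 2.

Lemma clamp_lo s : s <= 0 -> clamp s = 0.
Proof. by move=> ?; rewrite /clamp !Rabs_left1; lra. Qed.

Lemma clamp_hi s : 1 <= s -> clamp s = 1.
Proof. by move=> ?; rewrite /clamp !Rabs_right; lra. Qed.

Lemma clamp_mid s : 0 <= s <= 1 -> clamp s = s.
Proof. by move=> ?; rewrite /clamp Rabs_right ?Rabs_left1; lra. Qed.

Lemma clamp_continuity (c : R) : continuity (fun t => clamp (t - c)).
Proof.
have cid (b : R) : continuity (fun t => t - b).
  by apply: continuity_minus; [exact: derivable_continuous derivable_id
    | exact: continuity_const].
have cabs (b : R) : continuity (fun t => Rabs (t - b)).
  exact: (continuity_comp _ _ (cid b) Rcontinuity_abs).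
have cabs1 : continuity (fun t => Rabs (t - c - 1)).
  have -> : (fun t => Rabs (t - c - 1)) = (fun t => Rabs (t - (c + 1))); last exact: cabs.
  by apply: FunctionalExtensionality.functional_extensionality => t; congr Rabs; lra.
rewrite /clamp /Rdiv; apply: continuity_mult; last exact: continuity_const.
apply: continuity_plus; last exact: continuity_const.
exact: continuity_minus.
Qed.

(** The piecewise linear interpolant of [Q] at the integers from [a] to [a + n], as a sum of
    increments each switched on by one ramp. No case distinction on [t] occurs, so continuity is
    immediate. *)
Fixpoint polyline (Q : Z -> Z) (a : Z) (n : nat) (t : R) : R :=
  if n is S m then
    polyline Q a m t +
    IZR (Q (a + Z.of_nat m + 1)%Z - Q (a + Z.of_nat m)%Z) * clamp (t - IZR (a + Z.of_nat m))
  else IZR (Q a).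

Lemma polyline_continuity Q a n : continuity (polyline Q a n).
Proof.
elim: n => [|n IH] /=; first exact: continuity_const.
apply: continuity_plus => //; apply: continuity_mult; last exact: clamp_continuity.
exact: continuity_const.
Qed.

Lemma polyline_right Q a n t :
  IZR (a + Z.of_nat n) <= t -> polyline Q a n t = IZR (Q (a + Z.of_nat n)%Z).
Proof.
elim: n => [|n IH]; first by rewrite Z.add_0_r.
have -> : (a + Z.of_nat n.+1 = a + Z.of_nat n + 1)%Z by lia.
rewrite plus_IZR => ht /=.
by rewrite IH ?clamp_hi ?minus_IZR; lra.
Qed.

Lemma polyline_segment Q a n k t :
  (a <= k < a + Z.of_nat n)%Z -> IZR k <= t <= IZR k + 1 ->
  polyline Q a n t = IZR (Q k) + IZR (Q (k + 1)%Z - Q k) * (t - IZR k).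
Proof.
elim: n => [|n IH] hk ht; first lia.
have [e|ne] := Z.eq_dec k (a + Z.of_nat n); rewrite /=.
  rewrite -e clamp_mid; last lra.
  by rewrite polyline_right -e //; lra.
have lt : IZR k + 1 <= IZR (a + Z.of_nat n) by rewrite -plus_IZR; apply: IZR_le; lia.
rewrite IH //; last lia.
by rewrite clamp_lo; lra.
Qed.

Lemma polyline_int Q a n k :
  (a <= k <= a + Z.of_nat n)%Z -> polyline Q a n (IZR k) = IZR (Q k).
Proof.
move=> hk; have [e|ne] := Z.eq_dec k (a + Z.of_nat n).
  by rewrite polyline_right -e //; lra.
by rewrite (@polyline_segment _ _ _ k); [lra | lia | lra].
Qed.

End PiecewiseLinear.

(** * Drawings on the integer grid *)

Section Layout.
Variables (V : finType) (E : rel V).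
Local Open Scope Z_scope.

Implicit Types (y x : V -> Z) (P : V -> V -> Z -> Z) (S : {set V}).

(** Only integer heights are compared: between consecutive ones both curves are linear, so the order
    persists there. *)
Definition left_of y P u1 v1 u2 v2 : Prop :=
  forall k, y u1 <= k <= y v1 -> y u2 <= k <= y v2 ->
    P u1 v1 k <= P u2 v2 k /\
    (P u1 v1 k = P u2 v2 k ->
     exists w, (w = u1 \/ w = v1) /\ (w = u2 \/ w = v2) /\ k = y w).

(* [P u v k] is the abscissa at which the edge [(u, v)] meets the horizontal line of height [k]. *)
Record layout S y x P : Prop := Layout {
  layout_inj : forall u v, u \in S -> v \in S -> x u = x v -> y u = y v -> u = v;
  layout_edge : forall u v, u \in S -> v \in S -> E u v ->
    y u < y v /\ P u v (y u) = x u /\ P u v (y v) = x v;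
  layout_avoid : forall u v w, u \in S -> v \in S -> w \in S -> E u v ->
    y u <= y w <= y v -> P u v (y w) = x w -> w = u \/ w = v;
  layout_pair : forall u1 v1 u2 v2, u1 \in S -> v1 \in S -> u2 \in S -> v2 \in S ->
    E u1 v1 -> E u2 v2 -> (u1, v1) <> (u2, v2) ->
    left_of y P u1 v1 u2 v2 \/ left_of y P u2 v2 u1 v1 }.

(** The differences [c - a] and [d - b] are nonnegative and get positive weights, so their weighted
    sum vanishes only if both do. *)
Lemma interpolation_eq (a b c d s : R) :
  Rlt 0 s -> Rlt s 1 -> Rle a c -> Rle b d ->
  Rplus a (Rmult (Rminus b a) s) = Rplus c (Rmult (Rminus d c) s) -> a = c /\ b = d.
Proof. by move=> *; split; nra. Qed.

(** A meeting strictly between heights [k] and [k + 1] would force equality at both, hence a common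
    vertex at each. The lower one is the tail of both edges and the upper one the head of both, so
    the edges would coincide. *)
Lemma left_of_no_meet y P u1 v1 u2 v2 k (s : R) :
  left_of y P u1 v1 u2 v2 -> (u1, v1) <> (u2, v2) ->
  y u1 <= k -> k + 1 <= y v1 -> y u2 <= k -> k + 1 <= y v2 ->
  Rlt 0 s -> Rlt s 1 ->
  Rplus (IZR (P u1 v1 k)) (Rmult (IZR (P u1 v1 (k + 1) - P u1 v1 k)) s) <>
  Rplus (IZR (P u2 v2 k)) (Rmult (IZR (P u2 v2 (k + 1) - P u2 v2 k)) s).
Proof.
move=> lo ne h1 h2 h3 h4 s0 s1; rewrite !minus_IZR => eqs.
have [le0 c0] := lo k ltac:(lia) ltac:(lia).
have [le1 c1] := lo (k + 1) ltac:(lia) ltac:(lia).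
have [/eq_IZR e0 /eq_IZR e1] := interpolation_eq s0 s1 (IZR_le _ _ le0) (IZR_le _ _ le1) eqs.
have [w [wA [wB wk]]] := c0 e0; have [w' [wA' [wB' wk']]] := c1 e1.
have wu1 : w = u1 by case: wA => // e; subst; lia.
have wu2 : w = u2 by case: wB => // e; subst; lia.
have wv1 : w' = v1 by case: wA' => // e; subst; lia.
have wv2 : w' = v2 by case: wB' => // e; subst; lia.
by subst.
Qed.

Lemma layout_drawing y x P :
  layout [set: V] y x P ->
  upward_planar_layered_drawing E y (fun u => IZR (x u))
    (fun u v => polyline (P u v) (y u) (Z.to_nat (y v - y u))).
Proof.
move=> [inj edge avoid pair].
have fint u v k : E u v -> y u <= k <= y v ->
    polyline (P u v) (y u) (Z.to_nat (y v - y u)) (IZR k) = IZR (P u v k).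
  by move=> ? ?; apply: polyline_int; lia.
split; [|split; [|split]].
- by move=> u v /eq_IZR ex ey; apply: inj.
- move=> u v uv; have [lt [e1 e2]] := edge u v (in_setT _) (in_setT _) uv.
  split=> //; split; first exact: polyline_continuity.
  by rewrite !fint ?e1 ?e2 //; lia.
- move=> u v w t [uv [le1 le2]] + et; subst t.
  move: le1 le2 => /le_IZR le1 /le_IZR le2.
  by rewrite fint // => /eq_IZR; apply: avoid; rewrite ?in_setT.
move=> u1 v1 u2 v2 t [uv1 [a1 b1]] [uv2 [a2 b2]] ne.
(* [k] is the floor of [t]. If [t] equals [k], the grid conditions apply directly; otherwise both
   edges span the whole strip from [k] to [k + 1]. *)
have [hk1 hk2] := archimed t; set k := (up t - 1)%Z.
have ek : IZR (up t) = Rplus (IZR k) 1 by rewrite /k minus_IZR; lra.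
have pr := pair u1 v1 u2 v2 (in_setT _) (in_setT _) (in_setT _) (in_setT _) uv1 uv2 ne.
have [et|net] := Req_dec t (IZR k).
  move: a1 b1 a2 b2; rewrite et => /le_IZR a1 /le_IZR b1 /le_IZR a2 /le_IZR b2.
  rewrite !fint // => /eq_IZR e12.
  have [w [wA [wB wk]]] : exists w, (w = u1 \/ w = v1) /\ (w = u2 \/ w = v2) /\ k = y w.
    case: pr => lo.
      by have [_ /(_ e12)] := lo k (conj a1 b1) (conj a2 b2).
    by have [_ /(_ (esym e12)) [w [? [? ?]]]] := lo k (conj a2 b2) (conj a1 b1); exists w.
  exists w; do 3 (split=> //); first by rewrite wk.
  have [_ [e1 e2]] := edge _ _ (in_setT _) (in_setT _) uv1.
  by rewrite wk; case: wA => ->; rewrite ?e1 ?e2.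
have kt : Rlt (IZR k) t by case: (Rdichotomy _ _ net); lra.
have c1 : y u1 <= k.
  by suff : y u1 < k + 1; [lia | apply: lt_IZR; rewrite plus_IZR; lra].
have c2 : y u2 <= k.
  by suff : y u2 < k + 1; [lia | apply: lt_IZR; rewrite plus_IZR; lra].
have d1 : k < y v1 by apply: lt_IZR; lra.
have d2 : k < y v2 by apply: lt_IZR; lra.
rewrite !(@polyline_segment _ _ _ k) //; try lia; try lra.
move=> e; exfalso.
case: pr => lo.
  by apply: (@left_of_no_meet _ _ _ _ _ _ k (Rminus t (IZR k)) lo ne); try lia; try lra.
by apply: (@left_of_no_meet _ _ _ _ _ _ k (Rminus t (IZR k)) lo (not_eq_sym ne)); try lia; try lra.
Qed.

(** Everything drawn for [S2] is strictly left of everything drawn for [S1], so only the connecting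
    edge [(s, t)] can create new conflicts. *)
Lemma layout_glue S1 S2 y x P s t :
  layout S1 y x P -> layout S2 y x P ->
  (forall u w, u \in S1 -> w \in S2 -> x w < x u) ->
  (forall u v w k, u \in S1 -> v \in S1 -> w \in S2 -> E u v -> y u <= k <= y v ->
     x w < P u v k) ->
  (forall u v w k, u \in S2 -> v \in S2 -> w \in S1 -> E u v -> y u <= k <= y v ->
     P u v k < x w) ->
  (forall u v u' v' k, u \in S1 -> v \in S1 -> u' \in S2 -> v' \in S2 ->
     E u v -> E u' v' -> y u <= k <= y v -> y u' <= k <= y v' -> P u' v' k < P u v k) ->
  (forall u v, E u v -> (u \in S1 /\ v \in S2) \/ (u \in S2 /\ v \in S1) -> u = s /\ v = t) ->
  y s < y t /\ P s t (y s) = x s /\ P s t (y t) = x t ->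
  (forall w, w \in S1 \/ w \in S2 -> y s <= y w <= y t -> P s t (y w) = x w -> w = s \/ w = t) ->
  (forall u v, (u \in S1 /\ v \in S1) \/ (u \in S2 /\ v \in S2) -> E u v ->
     left_of y P s t u v \/ left_of y P u v s t) ->
  layout (S1 :|: S2) y x P.
Proof.
move=> [inj1 edge1 avoid1 pair1] [inj2 edge2 avoid2 pair2] sxx spx sxp spp cross enew vnew pnew.
have split_edge u v : u \in S1 :|: S2 -> v \in S1 :|: S2 -> E u v ->
    (u \in S1 /\ v \in S1) \/ (u \in S2 /\ v \in S2) \/ (u = s /\ v = t).
  rewrite !inE => /orP[] hu /orP[] hv uv; [tauto| | |tauto].
    by right; right; apply: cross => //; left.
  by right; right; apply: cross => //; right.
split.
- move=> u v; rewrite !inE => /orP[] hu /orP[] hv ex ey.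
  + exact: inj1.
  + by have := sxx _ _ hu hv; lia.
  + by have := sxx _ _ hv hu; lia.
  + exact: inj2.
- move=> u v hu hv uv; case: (split_edge _ _ hu hv uv) => [[? ?]|[[? ?]|[-> ->]]] //.
  + exact: edge1.
  + exact: edge2.
- move=> u v w hu hv; rewrite inE => /orP hw uv rg ew.
  case: (split_edge _ _ hu hv uv) => [[iu iv]|[[iu iv]|[eu ev]]].
  + case: hw => hw; first exact: avoid1 ew.
    by have := spx _ _ _ _ iu iv hw uv rg; lia.
  + case: hw => hw; last exact: avoid2 ew.
    by have := sxp _ _ _ _ iu iv hw uv rg; lia.
  + by subst; apply: vnew.
move=> u1 v1 u2 v2 iu1 iv1 iu2 iv2 e1 e2 ne.
have sep u v u' v' : u \in S1 -> v \in S1 -> u' \in S2 -> v' \in S2 ->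
    E u v -> E u' v' -> left_of y P u' v' u v.
  move=> a b c d uv uv' k r1 r2.
  by have := spp _ _ _ _ _ a b c d uv uv' r2 r1; split; lia.
case: (split_edge _ _ iu1 iv1 e1) => [[a b]|[[a b]|[a b]]];
  case: (split_edge _ _ iu2 iv2 e2) => [[c d]|[[c d]|[c d]]].
- exact: pair1.
- by right; apply: sep.
- by subst; case: (pnew u1 v1); tauto.
- by left; apply: sep.
- exact: pair2.
- by subst; case: (pnew u1 v1); tauto.
- by subst; case: (pnew u2 v2); tauto.
- by subst; case: (pnew u2 v2); tauto.
- by subst; case: ne.
Qed.

(* The last two fields keep the region to the right of the root and above it free, so that an
   edge to the parent of the root can leave from there. *)
Record rooted_layout S v (b B lo hi : Z) y x P : Prop := RootedLayout {
  rooted_layoutP : layout S y x P;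
  rooted_root : v \in S;
  rooted_span : forall u w, u \in S -> w \in S -> E u w -> y w - y u <= B;
  rooted_low : forall u, u \in S -> u <> v -> y v - b < y u;
  rooted_x : forall u, u \in S -> lo <= x u <= hi;
  rooted_P : forall u w k, u \in S -> w \in S -> E u w -> y u <= k <= y w -> lo <= P u w k <= hi;
  rooted_x_free : forall u, u \in S -> y v <= y u -> x u <= x v;
  rooted_P_free : forall u w k, u \in S -> w \in S -> E u w -> y u <= k <= y w -> y v <= k ->
    P u w k <= x v }.

Lemma rooted_layout_shift S v b B lo hi y x P p q :
  rooted_layout S v b B lo hi y x P ->
  rooted_layout S v b B (lo + p) (hi + p) (fun u => y u + q) (fun u => x u + p)
    (fun u w k => P u w (k - q) + p).
Proof.
move=> [[inj edge avoid pair] root span low hx hP fx fP]; split => //.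
- split.
  + by move=> u w *; apply: inj => //; lia.
  + move=> u w a c uw; have [? [? ?]] := edge _ _ a c uw.
    by rewrite !Z.add_simpl_r; lia.
  + move=> u w z ? ? ? ? ?; rewrite Z.add_simpl_r => ?.
    by apply: avoid => //; lia.
  + have sh u1 v1 u2 v2 : left_of y P u1 v1 u2 v2 ->
      left_of (fun u => y u + q) (fun u w k => P u w (k - q) + p) u1 v1 u2 v2.
      move=> h k r1 r2; have [||le ex] := h (k - q) _ _; try lia.
      split; first lia.
      move=> e; have [|w [? [? ?]]] := ex; first lia.
      by exists w; do 2 (split=> //); lia.
    by move=> u1 v1 u2 v2 ? ? ? ? ? ? ne; case: (pair u1 v1 u2 v2) => // h; [left|right]; apply: sh.
- by move=> u w a c uw; have := span _ _ a c uw; lia.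
- by move=> u hu ne; have := low _ hu ne; lia.
- by move=> u hu; have := hx _ hu; lia.
- by move=> u w k a c uw r; have := hP _ _ (k - q) a c uw; lia.
- by move=> u hu ?; have := fx _ hu; lia.
- by move=> u w k a c uw r ?; have := fP _ _ (k - q) a c uw; lia.
Qed.

Lemma rooted_layout_ext S v b B lo hi y x P y' x' P' :
  (forall u, u \in S -> y' u = y u) -> (forall u, u \in S -> x' u = x u) ->
  (forall u w, u \in S -> w \in S -> P' u w = P u w) ->
  rooted_layout S v b B lo hi y x P -> rooted_layout S v b B lo hi y' x' P'.
Proof.
move=> ey ex eP [[inj edge avoid pair] root span low hx hP fx fP]; split => //.
- split.
  + by move=> u w hu hw; rewrite !ex ?ey //; apply: inj.
  + by move=> u w hu hw; rewrite !ex ?ey ?eP //; apply: edge.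
  + by move=> u w z hu hw hz; rewrite !ex ?ey ?eP //; apply: avoid.
  + move=> u1 v1 u2 v2 h1 h2 h3 h4 e1 e2 ne.
    have sh a c d e : a \in S -> c \in S -> d \in S -> e \in S ->
        left_of y P a c d e -> left_of y' P' a c d e.
      move=> ia ic id ie h k; rewrite !ey ?eP // => r1 r2.
      have [le co] := h k r1 r2; split=> // /co [w [wA [wB wk]]].
      by exists w; do 2 (split=> //); rewrite ey //; case: wA => ->.
    by case: (pair u1 v1 u2 v2) => // h; [left|right]; apply: sh.
- by move=> u w hu hw; rewrite !ey //; apply: span.
- by move=> u hu; rewrite !ey //; apply: low.
- by move=> u hu; rewrite ex //; apply: hx.
- by move=> u w k hu hw; rewrite !ey ?eP //; apply: hP.
- by move=> u hu; rewrite !ey ?ex //; apply: fx.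
- by move=> u w k hu hw; rewrite !ey ?ex ?eP //; apply: fP.
Qed.

(** [b] bounds the depth below [v] and [B] the span. As [rooted_low] is strict, [b = 0] puts all
    other vertices strictly above [v]. *)
Definition drawable S v b B : Prop :=
  exists y x P lo hi, rooted_layout S v b B lo hi y x P.

Lemma drawable_weaken S v b B b' : b <= b' -> drawable S v b B -> drawable S v b' B.
Proof.
move=> le [y [x [P [lo [hi [lay root span low hx hP fx fP]]]]]].
exists y, x, P, lo, hi; split=> // u hu ne.
by have := low _ hu ne; lia.
Qed.

Lemma drawable_place S v b B p q :
  drawable S v b B -> exists y x P lo, rooted_layout S v b B lo p y x P /\ y v = q.
Proof.
move=> [y [x [P [lo [hi /(rooted_layout_shift (p - hi) (q - y v)) h]]]]].
have e : hi + (p - hi) = p by lia.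
by rewrite e in h; do 4 eexists; split; [exact: h|cbv beta; lia].
Qed.

Lemma drawable1 v B : ~~ E v v -> drawable [set v] v 0 B.
Proof.
move=> nvv; have ne u w : u \in [set v] -> w \in [set v] -> E u w -> False.
  by rewrite !inE => /eqP -> /eqP ->; apply/negP.
exists (fun=> 0), (fun=> 0), (fun _ _ _ => 0), 0, 0; split => //; try (by move=> *; exfalso; eauto).
- split; try (by move=> *; exfalso; eauto).
  by move=> u w; rewrite !inE => /eqP -> /eqP ->.
- by rewrite inE.
- by move=> u; rewrite inE => /eqP.
Qed.


(** * Attaching the drawing of a child subtree *)

(** The root remains [v]: since [S2] lies left of [lo1], hence left of [v], only the connecting edge
    could obstruct the free region of [v]. *)
Lemma rooted_layout_glue S1 S2 v w b1 b2 b B lo1 hi1 lo2 hi2 hi y x P s t :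
  rooted_layout S1 v b1 B lo1 hi1 y x P -> rooted_layout S2 w b2 B lo2 hi2 y x P ->
  hi2 < lo1 -> hi1 <= hi -> b1 <= b ->
  (forall u, u \in S2 -> y v - b < y u) ->
  (forall u z, E u z -> (u \in S1 /\ z \in S2) \/ (u \in S2 /\ z \in S1) -> u = s /\ z = t) ->
  y s < y t <= y s + B -> P s t (y s) = x s -> P s t (y t) = x t ->
  (forall k, y s <= k <= y t -> lo2 <= P s t k <= hi) ->
  (forall k, y s <= k <= y t -> y v <= k -> P s t k <= x v) ->
  (forall u, u \in S1 \/ u \in S2 -> y s <= y u <= y t -> P s t (y u) = x u -> u = s \/ u = t) ->
  (forall u z, u \in S1 -> z \in S1 -> E u z ->
     left_of y P s t u z \/ left_of y P u z s t) ->
  (forall u z, u \in S2 -> z \in S2 -> E u z ->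
     left_of y P s t u z \/ left_of y P u z s t) ->
  rooted_layout (S1 :|: S2) v b B lo2 hi y x P.
Proof.
move=> [lay1 root1 span1 low1 x1 P1 fx1 fP1] [lay2 root2 span2 low2 x2 P2 fx2 fP2].
move=> sep hi1hi b1b low cross st Ps Pt PB Pv Pvx PS1 PS2.
have split_edge u z : u \in S1 :|: S2 -> z \in S1 :|: S2 -> E u z ->
    (u \in S1 /\ z \in S1) \/ (u \in S2 /\ z \in S2) \/ (u = s /\ z = t).
  rewrite !inE => /orP[] hu /orP[] hz uz; [tauto| | |tauto].
    by right; right; apply: cross => //; left.
  by right; right; apply: cross => //; right.
have xv := x1 v root1; have xw := x2 w root2.
split.
- apply: (@layout_glue _ _ _ _ _ s t) => //.
  + by move=> u z /x1 ? /x2; lia.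
  + by move=> u z a k iu iz /x2 ? uz r; have := P1 _ _ _ iu iz uz r; lia.
  + by move=> u z a k iu iz /x1 ? uz r; have := P2 _ _ _ iu iz uz r; lia.
  + move=> u z u' z' k iu iz iu' iz' uz uz' r r'.
    by have := P1 _ _ _ iu iz uz r; have := P2 _ _ _ iu' iz' uz' r'; lia.
  + by split; first lia.
  + by move=> u z [] []; [exact: PS1|exact: PS2].
- by rewrite inE root1.
- move=> u z iu iz uz; case: (split_edge _ _ iu iz uz) => [[? ?]|[[? ?]|[-> ->]]].
  + exact: span1.
  + exact: span2.
  + lia.
- move=> u; rewrite inE => /orP[iu ne|/low //].
  by have := low1 _ iu ne; lia.
- by move=> u; rewrite inE => /orP[/x1|/x2]; lia.
- move=> u z k iu iz uz; case: (split_edge _ _ iu iz uz) => [[a c]|[[a c]|[-> ->]]] r.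
  + by have := P1 _ _ _ a c uz r; lia.
  + by have := P2 _ _ _ a c uz r; lia.
  + exact: PB.
- move=> u; rewrite inE => /orP[|/x2]; first exact: fx1.
  by lia.
- move=> u z k iu iz uz; case: (split_edge _ _ iu iz uz) => [[a c]|[[a c]|[-> ->]]] r.
  + exact: fP1.
  + by have := P2 _ _ _ a c uz r; lia.
  + exact: Pv.
Qed.

(** The right border of [S2] is put at [lo1 - 2], which leaves the column [lo1 - 1] empty. [lane] is
    a function because [lo1] is known only once [S1] is placed. *)
Lemma drawable_merge S1 S2 v w b1 b2 B s t q (lane : Z -> Z) :
  (forall u, u \in S1 -> u \notin S2) ->
  (s \in S1 /\ t \in S2) \/ (s \in S2 /\ t \in S1) ->
  drawable S1 v b1 B -> drawable S2 w b2 B ->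
  exists y x P lo1 lo2,
    [/\ rooted_layout S1 v b1 B lo1 0 y x P, rooted_layout S2 w b2 B lo2 (lo1 - 2) y x P,
        y v = 0, y w = q &
        forall k, P s t k = if k =? y s then x s else if k =? y t then x t else lane lo1].
Proof.
move=> dis st /(drawable_place 0 0) [y1 [x1 [P1 [lo1 [r1 yv]]]]].
move=> /(drawable_place (lo1 - 2) q) [y2 [x2 [P2 [lo2 [r2 yw]]]]].
pose y u := if u \in S2 then y2 u else y1 u.
pose x u := if u \in S2 then x2 u else x1 u.
(* All mixed pairs get the connecting curve, so the same definition serves both orientations of the
   new edge. *)
pose P u z := if u \in S2 then (if z \in S2 then P2 u z else
      fun k => if k =? y s then x s else if k =? y t then x t else lane lo1)
    else if z \in S2 then
      fun k => if k =? y s then x s else if k =? y t then x t else lane lo1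
    else P1 u z.
have e1 A (f g : V -> A) u : u \in S1 -> (if u \in S2 then f u else g u) = g u.
  by move=> /dis /negbTE ->.
have e2 A (f g : V -> A) u : u \in S2 -> (if u \in S2 then f u else g u) = f u by move=> ->.
exists y, x, P, lo1, lo2; split.
- apply: rooted_layout_ext r1 => [u|u|u z]; rewrite /y /x /P; try exact: e1.
  by move=> /dis /negbTE -> /dis /negbTE ->.
- apply: rooted_layout_ext r2 => [u|u|u z]; rewrite /y /x /P; try exact: e2.
  by move=> -> ->.
- by rewrite /y e1 //; apply: rooted_root r1.
- by rewrite /y e2 //; apply: rooted_root r2.
- move=> k; rewrite {1}/P.
  by case: st => [[/dis /negbTE -> ->]|[-> /dis /negbTE ->]].
Qed.

(** With [w] at height [b + 1], all of [S2] is above [v], the lowest vertex of [S1]. The edge moves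
    left just above [v], climbs the column [lo1 - 1] and enters [w] from its free right side; if
    [b = 0] it goes directly to [w]. *)
Lemma drawable_up S1 S2 v w b B :
  (forall u, u \in S1 -> u \notin S2) ->
  (forall u z, E u z -> (u \in S1 /\ z \in S2) \/ (u \in S2 /\ z \in S1) -> u = v /\ z = w) ->
  0 <= b -> b + 1 <= B ->
  drawable S1 v 0 B -> drawable S2 w b B -> drawable (S1 :|: S2) v 0 B.
Proof.
move=> dis cross b0 bB d1 d2.
have v1 : v \in S1 by case: d1 => [? [? [? [? [? []]]]]].
have w2 : w \in S2 by case: d2 => [? [? [? [? [? []]]]]].
have [y [x [P [lo1 [lo2 [r1 r2 yv yw PE]]]]]] :=
  drawable_merge (b + 1) (fun lo => lo - 1) dis (or_introl (conj v1 w2)) d1 d2.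
exists y, x, P, lo2, 0.
have [lay1 _ span1 low1 x1 P1 fx1 fP1] := r1.
have [lay2 _ span2 low2 x2 P2 fx2 fP2] := r2.
have above1 u : u \in S1 -> u = v \/ 0 < y u.
  by move=> iu; case: (eqVneq u v) => [|/eqP ne]; [left|right; have := low1 u iu ne; lia].
have above2 u : u \in S2 -> 0 < y u.
  move=> iu; case: (eqVneq u w) => [->|/eqP ne]; first lia.
  by have := low2 u iu ne; lia.
have Pv : P v w (y v) = x v by rewrite PE Z.eqb_refl.
have Pw : P v w (y w) = x w by rewrite PE Z.eqb_refl; case: Z.eqb_spec => //; lia.
have Pm k : y v < k < y w -> P v w k = lo1 - 1.
  by rewrite PE => ?; do 2 (case: Z.eqb_spec; first lia).
have cases k : y v <= k <= y w -> k = y v \/ k = y w \/ y v < k < y w by lia.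
have xv := x1 v v1; have xw := x2 w w2.
apply: (rooted_layout_glue (s := v) (t := w) r1 r2) => //; try lia.
- by move=> u /above2; lia.
- by move=> k /cases [->|[->|/Pm ->]]; rewrite ?Pv ?Pw; lia.
- by move=> k /cases [->|[->|/Pm ->]]; rewrite ?Pv ?Pw; lia.
- move=> u hu /cases [e|[e|l]] ex.
  + by left; case: hu => [/above1 [//|]|/above2]; lia.
  + case: hu => hu; first by have := x1 u hu; rewrite e Pw in ex; lia.
    by right; apply: (layout_inj lay2) => //; rewrite -ex e.
  + by rewrite Pm // in ex; case: hu => [/x1|/x2]; lia.
- move=> u z iu iz uz; left=> k /cases ck rk.
  have Pk := P1 _ _ _ iu iz uz rk.
  case: ck => [e|[e|l]].
  (* Other vertices of [S1] are strictly above [v], so an edge of [S1] that reaches this height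
     starts at [v], and the contact is a shared endpoint. *)
  + have uv : u = v by case: (above1 _ iu) => //; lia.
    have [_ [Pu _]] := layout_edge lay1 iu iz uz.
    subst; rewrite Pv Pu; split=> [|_]; first lia.
    by exists v; do 2 (split; first by left).
  + by rewrite e Pw in Pk *; split; lia.
  + by rewrite Pm //; split; lia.
- move=> u z iu iz uz; right=> k rk /cases ck.
  have Pk := P2 _ _ _ iu iz uz rk.
  case: ck => [e|[e|l]].
  + by have := above2 _ iu; lia.
  (* From the height of [w] upwards the edges of [S2] stay weakly left of [w]; equality means
     passing through [w], which makes [w] an endpoint. *)
  + rewrite e in rk *; split=> [|ex]; first by rewrite Pw; apply: fP2 => //; lia.
    exists w; split; last by split=> //; right.
    by rewrite Pw in ex; case: (layout_avoid lay2 iu iz w2 uz rk ex); tauto.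
  + by rewrite Pm //; split; lia.
Qed.

(** Height [- b1 - 1] for [w] is below all of [S1], so the edge can pass underneath to the new
    column 1 and climb to [v], with span [b1 + 1]. In the new depth, one unit of the 2 is this gap
    and the other keeps [rooted_low] strict when [w] itself is lowest. *)
Lemma drawable_down S1 S2 v w b1 b2 B :
  (forall u, u \in S1 -> u \notin S2) ->
  (forall u z, E u z -> (u \in S1 /\ z \in S2) \/ (u \in S2 /\ z \in S1) -> u = w /\ z = v) ->
  0 <= b1 -> 0 <= b2 -> b1 + 1 <= B ->
  drawable S1 v b1 B -> drawable S2 w b2 B -> drawable (S1 :|: S2) v (b1 + b2 + 2) B.
Proof.
move=> dis cross b10 b20 bB d1 d2.
have v1 : v \in S1 by case: d1 => [? [? [? [? [? []]]]]].
have w2 : w \in S2 by case: d2 => [? [? [? [? [? []]]]]].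
have [y [x [P [lo1 [lo2 [r1 r2 yv yw PE]]]]]] :=
  drawable_merge (- b1 - 1) (fun=> 1) dis (or_intror (conj w2 v1)) d1 d2.
exists y, x, P, lo2, 1.
have [lay1 _ span1 low1 x1 P1 fx1 fP1] := r1.
have [lay2 _ span2 low2 x2 P2 fx2 fP2] := r2.
have above1 u : u \in S1 -> y w < y u.
  by move=> iu; case: (eqVneq u v) => [->|/eqP ne]; last have := low1 u iu ne; lia.
have above2 u : u \in S2 -> y w - b2 <= y u.
  move=> iu; case: (eqVneq u w) => [->|/eqP ne]; first lia.
  by have := low2 u iu ne; lia.
have Pw : P w v (y w) = x w by rewrite PE Z.eqb_refl.
have Pv : P w v (y v) = x v by rewrite PE Z.eqb_refl; case: Z.eqb_spec => //; lia.
have Pm k : y w < k < y v -> P w v k = 1.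
  by rewrite PE => ?; do 2 (case: Z.eqb_spec; first lia).
have cases k : y w <= k <= y v -> k = y w \/ k = y v \/ y w < k < y v by lia.
have xv := x1 v v1; have xw := x2 w w2.
apply: (rooted_layout_glue (s := w) (t := v) r1 r2) => //; try lia.
- by move=> u /above2; lia.
- by move=> k /cases [->|[->|/Pm ->]]; rewrite ?Pv ?Pw; lia.
- by move=> k /cases [->|[->|l]] vk; rewrite ?Pv ?Pw; lia.
- move=> u hu /cases [e|[e|l]] ex.
  + left; case: hu => [/above1|hu]; first lia.
    by apply: (layout_inj lay2) => //; rewrite -ex e.
  + case: hu => hu; last by have := x2 u hu; rewrite e Pv in ex; lia.
    by right; apply: (layout_inj lay1) => //; rewrite -ex e.
  + by rewrite Pm // in ex; case: hu => [/x1|/x2]; lia.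
- move=> u z iu iz uz; right=> k rk /cases ck.
  have Pk := P1 _ _ _ iu iz uz rk.
  case: ck => [e|[e|l]].
  + by have := above1 _ iu; lia.
  + rewrite e in rk *; split=> [|ex]; first by rewrite Pv; apply: fP1 => //; lia.
    exists v; split; last by split=> //; right.
    by rewrite Pv in ex; case: (layout_avoid lay1 iu iz v1 uz rk ex); tauto.
  + by rewrite Pm //; split; lia.
- move=> u z iu iz uz; right=> k rk /cases ck.
  have Pk := P2 _ _ _ iu iz uz rk.
  case: ck => [e|[e|l]].
  + rewrite e in rk *; split=> [|ex]; first by rewrite Pw; apply: fP2 => //; lia.
    exists w; split; last by split=> //; left.
    by rewrite Pw in ex; case: (layout_avoid lay2 iu iz w2 uz rk ex); tauto.
  + by rewrite e Pv in Pk *; split; lia.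
  + by rewrite Pm //; split; lia.
Qed.

Lemma drawable_span r b B : drawable [set: V] r b B -> span_at_most E (IZR B).
Proof.
move=> [y [x [P [lo [hi [lay _ span _ _ _ _ _]]]]]].
exists y, (fun u => IZR (x u)), (fun u v => polyline (P u v) (y u) (Z.to_nat (y v - y u))).
split; first exact: layout_drawing.
by move=> u v uv; apply: IZR_le; apply: span; rewrite ?in_setT.
Qed.

End Layout.
(** * Rooted trees *)

Section SpanningParent.
Variables (V : finType) (E : rel V).

Lemma uadj_sym u v : uadj E u v = uadj E v u.
Proof. by rewrite /uadj orbC. Qed.

(** [dep] is the distance from [r], and the parent is the predecessor on a shortest path. *)
Lemma connected_parent (r : V) : (forall u v, connect (uadj E) u v) ->
  exists (p : V -> V) (dep : V -> nat), dep r = 0 /\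
    forall u, u != r -> uadj E (p u) u /\ dep u = (dep (p u)).+1.
Proof.
move=> conn.
pose reach u n := [exists t : n.-tuple V, path (uadj E) r t && (last r t == u)].
have reachI q : path (uadj E) r q -> reach (last r q) (size q).
  by move=> hq; apply/existsP; exists (in_tuple q); rewrite hq eqxx.
have ex u : exists n, reach u n.
  by have /connectP[q hq ->] := conn r u; exists (size q); apply: reachI.
pose dep u := ex_minn (ex u).
have depP u : exists2 q, path (uadj E) r q /\ last r q = u & size q = dep u.
  rewrite /dep; case: ex_minnP => n /existsP[t /andP[ht /eqP lt]] _.
  by exists t; rewrite ?size_tuple.
have dep_le q : path (uadj E) r q -> dep (last r q) <= size q.
  by move=> /reachI h; rewrite {1}/dep; case: ex_minnP => n _; apply.
have par u : u != r -> exists w, uadj E w u && (dep u == (dep w).+1).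
  have [q [hq lq] sq] := depP u; case/lastP: q hq lq sq => [_ /= -> |q z]; first by rewrite eqxx.
  (* On a shortest path to [u], the part before the last edge is shortest too: a shorter replacement
     would extend to a shorter path to [u]. *)
  rewrite rcons_path last_rcons size_rcons => /andP[hq hz] ez sq _; subst z.
  exists (last r q); rewrite hz -sq eqSS eqn_leq dep_le // andbT.
  have [q' [hq' lq'] <-] := depP (last r q).
  by rewrite -ltnS sq -(size_rcons q' u) -{1}(last_rcons r q' u) dep_le // rcons_path hq' lq'.
(* The default is taken only at [r], whose depth 0 is not a successor. *)
exists (fun u => odflt u [pick w | uadj E w u && (dep u == (dep w).+1)]), dep; split.
  by apply/eqP; rewrite -leqn0; apply: (dep_le [::]).
move=> u /par [w hw]; case: pickP => [z /andP[? /eqP] //|no].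
by rewrite no in hw.
Qed.

(* The n - 1 parent edges are pairwise distinct, so in a tree they are all the edges. *)
Lemma tree_parent (r : V) : directed_tree E ->
  exists (p : V -> V) (dep : V -> nat),
    [/\ dep r = 0, forall u, u != r -> dep u = (dep (p u)).+1,
        forall u, u != r -> uadj E (p u) u &
        forall u v, E u v -> (u != r /\ p u = v) \/ (v != r /\ p v = u)].
Proof.
move=> [_ [_ [conn card]]]; have [p [dep [dep0 par]]] := connected_parent r conn.
exists p, dep; split=> // [u /par[]//|u /par[]//|u v uv].
pose h u := if E u (p u) then (u, p u) else (p u, u).
have hcases w : h w = (w, p w) \/ h w = (p w, w) by rewrite /h; case: ifP; tauto.
have hE w : w != r -> E (h w).1 (h w).2.
  by move=> /par[] /orP[]; rewrite /h; case: ifP.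
(* Two distinct vertices with the same parent edge would be parents of each other, which the depths
   exclude. *)
have hinj : {in [set~ r] &, injective h}.
  move=> a c; rewrite !inE => /par[_ da] /par[_ dc] e.
  move: (hcases a) (hcases c); rewrite e; case=> -> [] [] e1 e2 //; exfalso;
    by have := congr1 dep e1; have := congr1 dep e2; lia.
have : h @: [set~ r] = [set q : V * V | E q.1 q.2].
  apply/eqP; rewrite eqEcard card_in_imset // card cardsC1 leqnn andbT.
  by apply/subsetP => z /imsetP[w]; rewrite !inE => /hE hw ->.
move=> /setP /(_ (u, v)); rewrite inE uv => /imsetP[w]; rewrite !inE => wr.
by case: (hcases w) => -> [-> ->]; [left|right].
Qed.

End SpanningParent.

(** * The depth recurrence *)

Fixpoint depth_bound (m h : nat) : nat :=
  if h is h'.+1 then m * (depth_bound m h' + 2) else 0.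

Lemma depth_bound_mono m h k : 0 < m -> h <= k -> depth_bound m h <= depth_bound m k.
Proof.
move=> m0; elim: h k => [|h IH] [|k] //= hk.
by rewrite leq_pmul2l // leq_add2r IH.
Qed.

(** The summand 4 makes the induction close: multiplying by [m] leaves a surplus of [2 * m], which
    is at least 4. *)
Lemma depth_bound_le m h : 1 < m -> depth_bound m h + 4 <= 4 * m ^ h.
Proof.
move=> m1; elim: h => [|h IH] //=.
rewrite expnS mulnCA; apply: leq_trans (leq_mul (leqnn m) IH).
have -> : m * (depth_bound m h + 4) = m * (depth_bound m h + 2) + m * 2.
  by rewrite -mulnDr -addnA.
by rewrite leq_add2l (leq_mul m1 (leqnn 2)).
Qed.

(** * Descendants and partial subtrees *)

Section RootedTree.
Variables (V : finType) (E : rel V) (r : V) (p : V -> V) (dep : V -> nat).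
Hypothesis E_dag : dag E.
Hypothesis dep_root : dep r = 0.
Hypothesis dep_parent : forall u, u != r -> dep u = (dep (p u)).+1.
Hypothesis edge_parent : forall u v, E u v -> (u != r /\ p u = v) \/ (v != r /\ p v = u).

(** The descendants of [v]: the depth difference fixes how many parent steps must lead from [u] to
    [v], so no closure is required. *)
Definition subtree v := [set u | (dep v <= dep u) && (iter (dep u - dep v) p u == v)].

Lemma subtree_root v : v \in subtree v.
Proof. by rewrite inE leqnn subnn eqxx. Qed.

Lemma subtree_down a w : a != r -> p a \in subtree w -> a \in subtree w.
Proof.
move=> /dep_parent da; rewrite !inE da => /andP[le e].
by rewrite leqW // subSn // iterSr.
Qed.

Lemma subtree_up a w : a \in subtree w -> a != w -> a != r /\ p a \in subtree w.
Proof.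
rewrite !inE => /andP[le e] ne.
have lt : dep w < dep a.
  rewrite ltn_neqAle le andbT; apply: contraNneq ne => eqd.
  by move: e; rewrite eqd subnn.
have ar : a != r by apply: contraTneq lt => ->; rewrite dep_root.
have da := dep_parent ar; split=> //.
by move: lt e; rewrite da ltnS => lt; rewrite lt subSn // iterSr.
Qed.

Lemma subtree_dep a w : a \in subtree w -> dep w <= dep a.
Proof. by rewrite inE => /andP[]. Qed.

(** A vertex has only one ancestor at a given depth. *)
Lemma subtree_disjoint a w w' :
  a \in subtree w -> a \in subtree w' -> dep w = dep w' -> w = w'.
Proof. by rewrite !inE => /andP[_ /eqP e] /andP[_ /eqP e'] d; rewrite d e' in e. Qed.

Lemma subtree_ind w (Q : V -> Prop) :
  Q w -> (forall a, a != r -> p a \in subtree w -> Q (p a) -> Q a) ->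
  forall a, a \in subtree w -> Q a.
Proof.
move=> Qw step a; have [n] := ubnP (dep a); elim: n a => // n IH a lt ia.
case: (eqVneq a w) => [-> //|ne]; have [ar ip] := subtree_up ia ne.
by apply: step => //; apply: IH => //; rewrite -ltnS -dep_parent.
Qed.

Lemma subtreeT : subtree r = [set: V].
Proof.
apply/setP => u; rewrite [RHS]inE; have [n] := ubnP (dep u).
elim: n u => // n IH u lt; case: (eqVneq u r) => [->|ur]; first exact: subtree_root.
by apply: subtree_down => //; apply: IH; rewrite -ltnS -dep_parent.
Qed.

Definition child v w := (w != r) && (p w == v).

Lemma child_dep v w : child v w -> dep w = (dep v).+1.
Proof. by move=> /andP[/dep_parent -> /eqP ->]. Qed.

Lemma child_notin v w : child v w -> v \notin subtree w.
Proof. by move=> /child_dep dw; apply/negP => /subtree_dep; rewrite dw ltnn. Qed.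

Lemma subtree_child v w : child v w -> subtree w \subset subtree v.
Proof.
move=> /andP[wr /eqP pw]; apply/subsetP; apply: subtree_ind.
  by apply: subtree_down => //; rewrite pw subtree_root.
by move=> a ar _; apply: subtree_down.
Qed.

Lemma subtreeP v u : reflect (u = v \/ exists2 w, child v w & u \in subtree w) (u \in subtree v).
Proof.
apply: (iffP idP) => [|[->|[w /subtree_child /subsetP]]]; last exact.
  elim/subtree_ind: u / => [|a ar _ [pa|[w cw iw]]]; first by left.
    by right; exists a; [rewrite /child ar pa eqxx | exact: subtree_root].
  by right; exists w => //; apply: subtree_down.
exact: subtree_root.
Qed.

(** The part of [subtree v] drawn after the children in [ws] have been attached; the head of the
    list is attached last. *)
Definition bouquet v (ws : seq V) := [set u | (u == v) || has (fun w => u \in subtree w) ws].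

Lemma bouquet_cons v w ws : bouquet v (w :: ws) = bouquet v ws :|: subtree w.
Proof. by apply/setP => u; rewrite inE [RHS]inE [u \in bouquet _ _]inE /= orbCA orbC. Qed.

Lemma bouquet_disjoint v w ws u :
  all (child v) (w :: ws) -> w \notin ws -> u \in bouquet v ws -> u \notin subtree w.
Proof.
move=> /= /andP[cw /allP cws] nw; rewrite [u \in bouquet _ _]inE => /orP[/eqP ->|/hasP[w' w'ws iu']].
  exact: child_notin.
apply: contra nw => iu; rewrite (subtree_disjoint iu iu') //.
by rewrite (child_dep cw) (child_dep (cws _ w'ws)).
Qed.

(** Every edge joins a vertex to its parent, and only the parent edge of [w] leaves [subtree w]. Its
    direction is left open; acyclicity decides it for the callers. *)
Lemma bouquet_cross v w ws u z :
  all (child v) (w :: ws) -> w \notin ws -> E u z ->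
  (u \in bouquet v ws /\ z \in subtree w) \/ (u \in subtree w /\ z \in bouquet v ws) ->
  (u = v /\ z = w) \/ (u = w /\ z = v).
Proof.
move=> cws nw uz h.
have dis a := @bouquet_disjoint v w ws a cws nw.
have pw : p w = v by move: cws => /= /andP[/andP[_ /eqP]].
have key1 a : a != r -> a \in bouquet v ws -> p a \in subtree w -> False.
  by move=> ar /dis /negP ni ip; apply: ni; apply: subtree_down.
have key2 a : a != r -> a \in subtree w -> p a \in bouquet v ws -> a = w.
  move=> ar ia /dis; case: (eqVneq a w) => // ne.
  by have [_ ->] := subtree_up ia ne.
case: (edge_parent uz) => [[ur e]|[zr e]]; subst; case: h => [[h1 h2]|[h1 h2]].
- by case: (key1 u ur h1 h2).
- by right; rewrite (key2 u).
- by left; rewrite (key2 z).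
- by case: (key1 z zr h2 h1).
Qed.

Lemma bouquet_up v ws b B :
  uniq ws -> all (child v) ws -> all (E v) ws -> (0 <= b)%Z -> (b + 1 <= B)%Z ->
  (forall w, w \in ws -> drawable E (subtree w) w b B) -> drawable E (bouquet v ws) v 0 B.
Proof.
move=> + + + b0 bB; elim: ws => [|w ws IH].
  move=> *; have -> : bouquet v [::] = [set v] by apply/setP => u; rewrite !inE orbF.
  by apply: drawable1; apply/negP => vv; move: (E_dag vv); rewrite connect0.
rewrite bouquet_cons => /= /andP[nw un] cws /andP[vw Ews] dr.
have cws' : all (child v) ws by case/andP: cws.
apply: (drawable_up (w := w) (b := b)) => //.
- by move=> u; apply: bouquet_disjoint.
- move=> u z uz /(bouquet_cross cws nw uz) [//|[? ?]]; subst.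
  by move: (E_dag vw); rewrite connect1.
- by apply: IH => // u hu; apply: dr; rewrite inE hu orbT.
- by apply: dr; rewrite inE eqxx.
Qed.

(** The children in [ws'] are already drawn at depth 0; by [drawable_down] each child in [ws] then
    adds [b + 2]. *)
Lemma bouquet_down v ws ws' b B :
  uniq (ws ++ ws') -> all (child v) (ws ++ ws') -> all (E^~ v) ws -> (0 <= b)%Z ->
  (Z.of_nat (size ws) * (b + 2) + 1 <= B)%Z ->
  drawable E (bouquet v ws') v 0 B ->
  (forall w, w \in ws -> drawable E (subtree w) w b B) ->
  drawable E (bouquet v (ws ++ ws')) v (Z.of_nat (size ws) * (b + 2)) B.
Proof.
move=> + + + b0 + d0; elim: ws => [|w ws IH] //.
rewrite cat_cons bouquet_cons [size _]/= Nat2Z.inj_succ.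
move=> /= /andP[nw un] cws /andP[wv Ews] hB dr.
have cws' : all (child v) (ws ++ ws') by case/andP: cws.
have -> : (Z.succ (Z.of_nat (size ws)) * (b + 2) = Z.of_nat (size ws) * (b + 2) + b + 2)%Z by lia.
have hB' : (Z.of_nat (size ws) * (b + 2) + 1 <= B)%Z.
  by move: hB; rewrite Z.mul_succ_l; move: (_ * _)%Z => k; lia.
have k0 : (0 <= Z.of_nat (size ws) * (b + 2))%Z by apply: Z.mul_nonneg_nonneg; lia.
apply: (drawable_down (w := w)) => //.
- by move=> u; apply: bouquet_disjoint.
- move=> u z uz /(bouquet_cross cws nw uz) [[? ?]|//]; subst.
  by move: (E_dag wv); rewrite connect1.
- by apply: IH => // u hu; apply: dr; rewrite inE hu orbT.
- by apply: dr; rewrite inE eqxx.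
Qed.

(** * Induction over subtrees *)

Variables (m l : nat).
Hypothesis m_gt0 : 0 < m.
Hypothesis edge_child : forall u, u != r -> uadj E (p u) u.
Hypothesis few_in : forall v, #|[pred w | child v w && E w v]| <= m.
Hypothesis path_le : forall x q, path E x q -> size q <= l.

(** Induction on the size of the subtree, with [h] free and the span bound fixed. Tails of edges
    into [v] are treated with [h - 1], heads of edges out of [v] with [l]. *)
Lemma subtree_drawable v h : h <= l ->
  (forall x q, path E x q -> last x q = v -> size q <= h) ->
  drawable E (subtree v) v (Z.of_nat (depth_bound m h)) (Z.of_nat (depth_bound m l) + 1).
Proof.
have [n] := ubnP #|subtree v|; elim: n v h => // n IH v h lt hl hv.
have IHc w k : child v w -> k <= l ->
    (forall x q, path E x q -> last x q = w -> size q <= k) ->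
    drawable E (subtree w) w (Z.of_nat (depth_bound m k)) (Z.of_nat (depth_bound m l) + 1).
  move=> cw; apply: IH; rewrite -ltnS; apply: leq_trans lt; rewrite ltnS proper_card //.
  rewrite properE subtree_child //=; apply/subsetPn; exists v; first exact: subtree_root.
  exact: child_notin.
pose ups := enum [pred w | child v w && E v w].
pose downs := enum [pred w | child v w && E w v].
have upsP w : w \in ups = child v w && E v w by rewrite mem_enum.
have downsP w : w \in downs = child v w && E w v by rewrite mem_enum.
have eq_subtree : subtree v = bouquet v (downs ++ ups).
  apply/setP => u; rewrite [RHS]inE; apply/subtreeP/idP => [[->|[w cw iu]]|].
  - by rewrite eqxx.
  - apply/orP; right; apply/hasP; exists w => //.
    rewrite mem_cat upsP downsP cw /=.
    by have := cw => /andP[/edge_child + /eqP pw]; rewrite pw /uadj orbC.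
  - move=> /orP[/eqP|/hasP[w]]; first by left.
    by rewrite mem_cat upsP downsP => /orP[]/andP[cw _] iu; right; exists w.
have un : uniq (downs ++ ups).
  rewrite cat_uniq !enum_uniq andbT /=; apply/hasPn => w /=.
  rewrite upsP downsP => /andP[_ vw]; apply/negP => /andP[_ wv].
  by move: (E_dag vw); rewrite connect1.
have cws : all (child v) (downs ++ ups).
  by apply/allP => w; rewrite mem_cat upsP downsP => /orP[]/andP[].
(* Paths ending at these children may be longer than [h], so the crude bound [l] is used; lifting
   their subtrees keeps the depth below [v] at 0. *)
have dups : drawable E (bouquet v ups) v 0 (Z.of_nat (depth_bound m l) + 1).
  apply: (@bouquet_up _ _ (Z.of_nat (depth_bound m l))); try lia.
  - exact: enum_uniq.
  - by apply/allP => w; rewrite upsP => /andP[].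
  - by apply/allP => w; rewrite upsP => /andP[].
  - by move=> w; rewrite upsP => /andP[cw _]; apply: IHc => // x q /path_le.
have sd : size downs <= m by rewrite -cardE few_in.
have Ed : all (E^~ v) downs by apply/allP => w; rewrite downsP => /andP[].
case: h hl hv => [|h] hl hv.
  (* For [h = 0] an edge into [v] would itself be too long a path. *)
  have d0 : downs = [::].
    case e : downs => [//|w s]; have : w \in downs by rewrite e mem_head.
    by rewrite downsP => /andP[_ wv]; have := hv w [:: v]; rewrite /= wv => /(_ isT erefl).
  by rewrite eq_subtree d0.
have bd : (Z.of_nat (size downs) * (Z.of_nat (depth_bound m h) + 2) <=
           Z.of_nat (depth_bound m h.+1))%Z.
  rewrite -(Nat2Z.inj_add _ 2) -Nat2Z.inj_mul; apply/Nat2Z.inj_le/leP.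
  exact: (leq_mul sd (leqnn _)).
have mono : (Z.of_nat (depth_bound m h.+1) <= Z.of_nat (depth_bound m l))%Z.
  by have /leP := depth_bound_mono m_gt0 hl; lia.
apply: (drawable_weaken bd); rewrite eq_subtree; apply: (@bouquet_down _ downs ups) => //; try lia.
  exact: (proj1 (Z.add_le_mono_r _ _ _) (Z.le_trans _ _ _ bd mono)).
move=> w; rewrite downsP => /andP[cw wv]; apply: IHc => //; first exact: ltnW.
(* A path ending at [w] extends by the edge to [v], so its length is at most [h]. *)
move=> x q hq lq; rewrite -ltnS -(size_rcons q v).
by apply: (hv x); rewrite ?last_rcons // rcons_path hq lq.
Qed.

End RootedTree.

(** * The bound for the whole tree *)

Lemma INR_expn m n : INR (m ^ n) = pow (INR m) n.
Proof. by elim: n => //= n <-; rewrite expnS; apply: mult_INR. Qed.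

Theorem mainTheorem9 :
  exists c : R, Rlt 0 c /\
  forall (V : finType) (E : rel V) (d l : nat),
    directed_tree E -> max_degree E = d -> (3 <= d)%N ->
    longest_path_length E l -> (1 <= l)%N ->
    span_at_most E (Rmult c (pow (INR (d - 1)) l)).
Proof.
(* The constant 4 comes from [depth_bound_le], whose surplus also absorbs the extra 1 in the
   span. *)
exists (IZR 4); split; first lra.
move=> V E d l tree deg d3 [[r [q [hq sq]]] path_le] _.
(* An edge into the start of a longest path would prolong that path. *)
have source w : ~~ E w r.
  by apply/negP => wr; have := path_le w (r :: q); rewrite /= wr hq sq ltnn => /(_ isT).
have [p [dep [dep0 dep_parent edge_child edge_parent]]] := tree_parent r tree.
have E_dag : dag E by case: tree.
have m1 : 1 < d - 1 by rewrite ltn_subRL.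
(* At [r] there are no incoming edges; elsewhere the parent takes up one of at most [d]
   neighbours. *)
have few_in v : #|[pred w | child r p v w && E w v]| <= d - 1.
  case: (eqVneq v r) => [->|vr].
    by rewrite eq_card0 // => w; rewrite inE (negbTE (source w)) andbF.
  have : #|[set w | uadj E v w]| <= d.
    by rewrite -deg; apply: (leq_bigmax v).
  rewrite (cardsD1 (p v)) inE uadj_sym edge_child // => h.
  have le : #|[pred w | child r p v w && E w v]| <= #|[set w | uadj E v w] :\ p v|.
    apply: subset_leq_card; apply/subsetP => w; rewrite !inE => /andP[cw wv].
    (* A child of [v] is not the parent of [v], since their depths differ by 2. *)
    rewrite /uadj wv orbT andbT; apply: contra_eq_neq (child_dep dep_parent cw) => ->.
    by rewrite (dep_parent v vr) -addn2 -[X in X != _]addn0 eqn_add2l.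
  rewrite subn1 -ltnS prednK ?(ltnW (ltnW d3)) //; apply: leq_trans h.
  by rewrite add1n ltnS.
have := subtree_drawable E_dag dep0 dep_parent edge_parent (ltnW m1) edge_child few_in path_le
  (leqnn l) (fun x q hq _ => path_le x q hq) (v := r).
rewrite (subtreeT dep_parent) => /drawable_span [y [x [f [drw span]]]].
exists y, x, f; split=> // u v uv; apply: Rle_trans (span _ _ uv) _.
have /leP /le_INR := depth_bound_le l m1.
rewrite plus_IZR -INR_IZR_INZ -INR_expn.
have -> : INR (4 * (d - 1) ^ l) = Rmult (IZR 4) (INR ((d - 1) ^ l)).
  by rewrite (mult_INR 4) INR_IZR_INZ.
by rewrite (plus_INR _ 4) [INR 4]INR_IZR_INZ /=; lra.
Qed.
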